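(* Let $G$ be a connected graph of diameter $2$. Then $\lambda_2(G) < -1/2$ if and only if $G$ is (isomorphic to) a connected induced subgraph of a graph of the form $$K_1 \oplus \Bigl( (p_1K_{r_1} \cup \cdots \cup p_kK_{r_k}) \cup q\bigl(K_1 \oplus (K_1 \cup K_2)\bigr) \cup s\,P_3 \Bigr)$$ for some positive integers $k, p_1,\ldots,p_k, r_1,\ldots,r_k, q, s$.
   Context: All graphs are finite, simple and connected unless they are explicitly written as disjoint unions. $d_G(u,v)$ is the length of a shortest path between $u$ and $v$, and the diameter of $G$ is the maximum of $d_G(u,v)$. The distance matrix of $G$ with vertices $v_1,\dots,v_n$ is $\mathbf{D}(G)=[d_G(v_i,v_j)]$; its (real) eigenvalues, counted with multiplicity, are ordered $\lambda_1(G)\ge\lambda_2(G)\ge\cdots\ge\lambda_n(G)$. $K_m$ is the complete graph on $m$ vertices and $P_3$ the path on $3$ vertices. $\cup$ denotes disjoint union of graphs, $mH$ is the disjoint union of $m$ copies of $H$, and $G_1\oplus G_2$ is the join: the disjoint union of $G_1$ and $G_2$ together with all edges between vertices of $G_1$ and vertices of $G_2$. The graphs displayed in the claim are called relaxed block star graphs. *)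

(* Defs.v *)
From HB Require Import structures.
From mathcomp Require Import all_boot all_order all_algebra.
From mathcomp Require Import polyrcf.
From mathcomp Require Import reals.

Set Implicit Arguments.
Unset Strict Implicit.
Unset Printing Implicit Defensive.

Import Order.TTheory GRing.Theory Num.Theory.

Record sgraph := SGraph {
  vertex :> finType;
  adj : rel vertex;
  adj_sym : symmetric adj;
  adj_irrefl : irreflexive adj }.
Arguments adj {s}.

Definition iso (G H : sgraph) : Prop :=
  exists2 f : G -> H, bijective f & forall u v, adj (f u) (f v) = adj u v.

Section Induced.
Variables (G : sgraph) (A : {set G}).
Definition induced_adj : rel {u : G | u \in A} := relpre val adj.
Fact induced_sym : symmetric induced_adj.
Proof. by move=> u v; apply: adj_sym. Qed.
Fact induced_irrefl : irreflexive induced_adj.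
Proof. by move=> u; apply: adj_irrefl. Qed.
Definition induced := SGraph induced_sym induced_irrefl.
End Induced.

Section Complete.
Variable n : nat.
Definition complete_adj : rel 'I_n := fun i j => i != j.
Fact complete_sym : symmetric complete_adj.
Proof. by move=> i j; apply: (congr1 negb); apply: eq_sym. Qed.
Fact complete_irrefl : irreflexive complete_adj.
Proof. by move=> i; rewrite /complete_adj eqxx. Qed.
Definition complete := SGraph complete_sym complete_irrefl.
End Complete.

Section PathGraph.
Variable n : nat.
Definition path_adj : rel 'I_n := fun i j => (i.+1 == j) || (j.+1 == i).
Fact path_adj_sym : symmetric path_adj.
Proof. by move=> i j; apply: orbC. Qed.
Fact path_adj_irrefl : irreflexive path_adj.
Proof. by move=> i; rewrite /path_adj orbb gtn_eqF. Qed.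
Definition path_graph := SGraph path_adj_sym path_adj_irrefl.
End PathGraph.

Section UnionJoin.
Variables G H : sgraph.

Definition union_adj : rel (G + H)%type := fun u v =>
  match u, v with
  | inl x, inl y => adj x y
  | inr x, inr y => adj x y
  | _, _ => false
  end.
Fact union_sym : symmetric union_adj.
Proof. by case=> x [] y //=; apply: adj_sym. Qed.
Fact union_irrefl : irreflexive union_adj.
Proof. by case=> x /=; apply: adj_irrefl. Qed.
Definition union := SGraph union_sym union_irrefl.

Definition join_adj : rel (G + H)%type := fun u v =>
  match u, v with
  | inl x, inl y => adj x y
  | inr x, inr y => adj x y
  | _, _ => true
  end.
Fact join_sym : symmetric join_adj.
Proof. by case=> x [] y //=; apply: adj_sym. Qed.
Fact join_irrefl : irreflexive join_adj.
Proof. by case=> x /=; apply: adj_irrefl. Qed.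
Definition join := SGraph join_sym join_irrefl.
End UnionJoin.

Section BigUnion.
Variables (I : finType) (F : I -> sgraph).
(* [tagged_as u v] transports [tagged v] to the fibre of [u]; its value is
   relevant only when the tags agree. *)
Definition big_union_adj : rel {i : I & F i} := fun u v =>
  (tag u == tag v) && adj (tagged u) (tagged_as u v).
Fact big_union_sym : symmetric big_union_adj.
Proof.
move=> [i x] [j y]; rewrite /big_union_adj /= eq_sym.
case: eqP => //= eji; case: i / eji x => x; rewrite !tagged_asE.
exact: adj_sym.
Qed.
Fact big_union_irrefl : irreflexive big_union_adj.
Proof.
by move=> [i x]; rewrite /big_union_adj (tagged_asE (u := Tagged F x)) /= adj_irrefl andbF.
Qed.
Definition big_union := SGraph big_union_sym big_union_irrefl.
End BigUnion.

Definition copies (m : nat) (H : sgraph) : sgraph :=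
  big_union (fun _ : 'I_m => H).

Definition relaxed_block_star k (p r : 'I_k -> nat) (q s : nat) : sgraph :=
  join (complete 1)
    (union
      (union (big_union (fun i : 'I_k => copies (p i) (complete (r i))))
             (copies q (join (complete 1) (union (complete 1) (complete 2)))))
      (copies s (path_graph 3))).

Section Distance.
Variable G : sgraph.

Definition connected : bool :=
  (0 < #|G|) && [forall u : G, forall v : G, connect adj u v].

Definition has_path (n : nat) (u v : G) : bool :=
  [exists p : n.-tuple G, [&& path adj u p, last u p == v & uniq (u :: p)]].

(* The search range is exhaustive, since a path has at most #|G|.-1 edges;
   the value is #|G| when v is not reachable from u. *)
Definition dist (u v : G) : nat :=
  find (fun n => has_path n u v) (iota 0 #|G|).

Definition diameter : nat := \max_(u : G) \max_(v : G) dist u v.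

Lemma dist_le (u v : G) (p : seq G) :
  path adj u p -> last u p = v -> dist u v <= size p.
Proof.
move=> pth lst; case: (shortenP pth) lst => p' pth' uni' sub' lst.
have szp' : size p' <= size p.
  by apply: uniq_leq_size sub'; case/andP: uni'.
apply: leq_trans szp'.
have ltG : size p' < #|G|.
  exact: leq_trans (eq_leq (esym (card_uniqP uni'))) (max_card _).
have hp : has_path (size p') u v.
  by apply/existsP; exists (in_tuple p'); rewrite pth' lst eqxx.
rewrite leqNgt; apply/negP => /(before_find 0).
by rewrite nth_iota // add0n hp.
Qed.

Lemma dist_path (u v : G) : connect adj u v ->
  exists p : seq G,
    [/\ path adj u p, last u p = v, uniq (u :: p) & size p = dist u v].
Proof.
case/connectP => p pth lst; case: (shortenP pth) lst => p' pth' uni' _ lst.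
have ltG : size p' < #|G|.
  exact: leq_trans (eq_leq (esym (card_uniqP uni'))) (max_card _).
have hh : has (fun n => has_path n u v) (iota 0 #|G|).
  apply/hasP; exists (size p'); first by rewrite mem_iota.
  by apply/existsP; exists (in_tuple p'); rewrite pth' lst eqxx.
have := nth_find 0 hh; rewrite has_find size_iota in hh.
rewrite nth_iota // add0n => /existsP[t /and3P[h1 /eqP h2 h3]].
by exists t; split=> //; rewrite size_tuple.
Qed.

End Distance.

Local Open Scope ring_scope.

Definition distance_mx (R : rcfType) (G : sgraph) : 'M[R]_#|G| :=
  \matrix_(i, j) (dist (enum_val i) (enum_val j))%:R.

(* The real roots of the characteristic polynomial, in nonincreasing order,
   each repeated according to its multiplicity. *)
Definition eigenvalues (R : rcfType) n (A : 'M[R]_n) : seq R :=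
  rev (flatten [seq nseq (mup a (char_poly A)) a | a <- rootsR (char_poly A)]).

(* Indexed from 1, with the largest eigenvalue first. *)
Definition dist_eigenvalue (R : rcfType) (G : sgraph) (i : nat) : R :=
  nth 0 (eigenvalues (distance_mx R G)) i.-1.

(* Main.v *)
(** For diameter 2 the matrix D + I/2 is 2J - 3/2 I - A, so its quadratic form
    depends on adjacency only and passes to induced subgraphs. By the spectral
    theorem, lambda_2 < -1/2 says that this form is not nonnegative on any plane,
    equivalently that it is negative definite on some hyperplane.

    P_4 and C_4 carry planes on which the form is positive, so in a graph with
    lambda_2 < -1/2 the closed neighbourhoods of adjacent vertices are nested, and
    a vertex of maximal degree is universal. For a join K_1 + H, completing the
    square at the apex gives

      2 (y_0 / 2 + sum_H y)^2 - y^T (A_H + 3/2 I) y,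

    so the condition becomes: A_H + 3/2 I is positive definite. This fails for the
    claw, the diamond, the butterfly and K_4 with a pendant edge, and the connected
    graphs avoiding these, P_4 and C_4 are the complete graphs, P_3 and the paw,
    which all satisfy it. *)

Require Import Defs.
From mathcomp Require Import all_boot all_order all_algebra.
From mathcomp Require Import reals.
From mathcomp Require Import polyrcf complex ring lra.

Set Implicit Arguments.
Unset Strict Implicit.
Unset Printing Implicit Defensive.

Import Order.TTheory GRing.Theory Num.Theory.
Local Open Scope ring_scope.

(** * The second eigenvalue and the quadratic form *)

(** When the characteristic polynomial splits over [R], the multiplicity [mup] of a root is its
    number of occurrences in [s], so nothing is lost by listing only real roots. *)
Lemma perm_eigenvalues (R : rcfType) n (A : 'M[R]_n) (s : seq R) :
  char_poly A = \prod_(y <- s) ('X - y%:P) -> perm_eq (eigenvalues A) s.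
Proof.
move=> pE; rewrite /eigenvalues perm_rev.
have p0 : char_poly A != 0 by rewrite monic_neq0 ?char_poly_monic.
have rE x : (x \in rootsR (char_poly A)) = (x \in s).
  have := roots_on_rootsR p0 x; rewrite in_itv /= => <-.
  by rewrite pE root_prod_XsubC.
have ru : uniq (rootsR (char_poly A)) by rewrite lt_sorted_uniq ?sorted_roots.
apply/allP => a _ /=; apply/eqP; rewrite count_flatten -map_comp.
under eq_map => x do rewrite /= count_nseq pE mu_prod_XsubC /=.
rewrite sumnE big_map.
under eq_bigr => x _ do rewrite eq_sym.
have [ain|anin] := boolP (a \in rootsR (char_poly A)).
  rewrite (bigD1_seq a) //= eqxx mul1n big1 ?addn0 // => x /negPf xa.
  by rewrite eq_sym xa.
rewrite big1_seq => [|x /= xin]; first by apply/esym/count_memPn; rewrite -rE.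
by case: eqVneq => [ax|_]; rewrite ?mul0n //; rewrite ax xin in anin.
Qed.

Lemma sorted_eigenvalues (R : rcfType) n (A : 'M[R]_n) :
  sorted >=%R (eigenvalues A).
Proof.
rewrite /eigenvalues rev_sorted.
have: sorted <%R (rootsR (char_poly A)) by apply: sorted_roots.
elim: (rootsR _) => //= x s IHs xs.
have /IHs {}IHs := path_sorted xs.
elim: (mup _ _) => //= m IHm; rewrite path_min_sorted //.
apply/allP => y; rewrite mem_cat => /orP[|]; first by case/nseqP => -> _.
case/flatten_mapP => z zs /nseqP[-> _].
by have /allP/(_ z zs)/ltW := order_path_min lt_trans xs.
Qed.

(** The list is nonincreasing, so its second entry is below [c] exactly when at most one entry
    reaches [c]; the size bound keeps [nth] off its default value. *)
Lemma second_eigenvalue_lt (R : rcfType) n (A : 'M[R]_n) (s : seq R) c :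
  (1 < size s)%N -> char_poly A = \prod_(y <- s) ('X - y%:P) ->
  ((eigenvalues A)`_1 < c) = (count (>= c) s <= 1)%N.
Proof.
move=> s1 /perm_eigenvalues perm_s.
have {s1} : (1 < size (eigenvalues A))%N by rewrite (perm_size perm_s).
move/permP: perm_s => /(_ (>= c)) <-.
have := sorted_eigenvalues A.
case: (eigenvalues A) => [|a [|b t]] //= /andP[ba bt] _.
rewrite ltNge; case: leP => [cb|bc].
  by rewrite (le_trans cb ba).
rewrite add0n (_ : count _ t = 0%N) ?addn0 ?leq_b1 //.
apply/eqP; rewrite -leqn0 leqNgt -has_count; apply/hasPn => x xt.
rewrite -ltNge; apply: le_lt_trans bc.
have /allP := order_path_min (rev_trans le_trans) bt.
by apply.
Qed.

Lemma char_poly_conj (K : fieldType) n (P A : 'M[K]_n) :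
  P \in unitmx -> char_poly (invmx P *m A *m P) = char_poly A.
Proof.
move=> uP; rewrite /char_poly.
have uPX : map_mx polyC P \in unitmx.
  by rewrite unitmxE det_map_mx rmorph_unit // -unitmxE.
suff -> : char_poly_mx (invmx P *m A *m P)
        = invmx (map_mx polyC P) *m char_poly_mx A *m map_mx polyC P.
  rewrite !det_mulmx mulrAC -det_mulmx mulVmx // det1 mul1r //.
rewrite /char_poly_mx !map_mxM map_invmx mulmxBr mulmxBl; congr (_ - _).
by rewrite scalar_mxC -mulmxA mulVmx // mulmx1.
Qed.

(** * Spectral decomposition of real symmetric matrices *)

Section RealQuadraticForm.
Local Open Scope sesquilinear_scope.
Variables (R : rcfType) (n : nat).
Implicit Types (A : 'M[R]_n) (x y : 'rV[R]_n).

Local Notation toC := (real_complex R).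
Local Notation ReM := (map_mx (@complex.Re R)).
Local Notation ImM := (map_mx (@complex.Im R)).

Definition bilin A x y : R := (x *m A *m y^T) 0 0.

Lemma bilinC A x y : A^T = A -> bilin A x y = bilin A y x.
Proof.
move=> symA; rewrite /bilin -[in LHS](trmxK (_ *m _)) mxE.
by rewrite !trmx_mul trmxK symA mulmxA.
Qed.

Lemma bilin_comb A (a b : R) x y : A^T = A ->
  bilin A (a *: x + b *: y) (a *: x + b *: y)
  = a ^+ 2 * bilin A x x + a * b * bilin A x y *+ 2 + b ^+ 2 * bilin A y y.
Proof.
move=> symA; have := bilinC x y symA; rewrite /bilin.
rewrite linearD !linearZ /= !mulmxDl !mulmxDr -!scalemxAl -!scalemxAr.
rewrite [(x *m A *m _) 0 0]lock; rewrite !mxE -lock => ->; ring.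
Qed.

(** For z = x + iy the mixed terms i (y A x^T - x A y^T) cancel by symmetry. *)
Lemma hermitian_form_ReIm A (z : 'rV[R[i]]_n) : A^T = A ->
  (z *m map_mx toC A *m z^t*) 0 0
  = (bilin A (ReM z) (ReM z) + bilin A (ImM z) (ImM z))%:C%C.
Proof.
move=> symA; pose x := ReM z; pose y := ImM z.
have zE : z = map_mx toC x + 'i%C *: map_mx toC y.
  by apply/rowP => j; rewrite !mxE -complexE.
have zcE : z^t* = map_mx toC x^T - 'i%C *: map_mx toC y^T.
  apply/colP => j; rewrite !mxE; case: (z 0 j) => a b.
  apply/eqP; rewrite eq_complex /=. simpc. done.
rewrite [in X in X *m _]zE zcE !mulmxDl !mulmxDr !mulmxN -!scalemxAl -!scalemxAr -!map_mxM.
have entry (B : 'M[R]_1) : (map_mx toC B) 0 0 = (B 0 0)%:C%C by rewrite mxE.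
have mxDE (B C : 'M[R[i]]_1) : (B + C) 0 0 = B 0 0 + C 0 0 by rewrite mxE.
have mxNE (B : 'M[R[i]]_1) : (- B) 0 0 = - B 0 0 by rewrite mxE.
have mxZE a (B : 'M[R[i]]_1) : (a *: B) 0 0 = a * B 0 0 by rewrite mxE.
rewrite !(mxDE, mxNE, mxZE, entry) -/(bilin A x x) -/(bilin A x y).
rewrite -/(bilin A y x) -/(bilin A y y) (bilinC y x symA).
rewrite addrA subrK mulrA -expr2 sqr_i mulN1r opprK rmorphD.
done.
Qed.

(** The complex spectral theorem is applied to [A] seen as a Hermitian matrix. The eigenvalues [e]
    are real but the eigenbasis [P] is complex, hence the two real forms on the left. *)
Lemma sym_diagonalization A : A^T = A ->
  exists (P : 'M[R[i]]_n) (e : 'I_n -> R),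
    [/\ P \is unitarymx, char_poly A = \prod_i ('X - (e i)%:P) &
        forall c (z : 'rV[R[i]]_n),
          bilin (A - c%:M) (ReM z) (ReM z) + bilin (A - c%:M) (ImM z) (ImM z)
          = \sum_i (e i - c) * (complex.Re ((z *m P^t*) 0 i) ^+ 2
                                 + complex.Im ((z *m P^t*) 0 i) ^+ 2)].
Proof.
move=> symA; pose AC := map_mx toC A.
have hermA : AC \is hermsymmx.
  apply: realsym_hermsym.
    by apply/is_hermitianmxP; rewrite expr0 scale1r map_mx_id // map_trmx symA.
  by apply/mxOverP => i j; rewrite mxE complex_real.
pose P := spectralmx AC; pose d := spectral_diag AC.
have uP : P \is unitarymx by apply: spectral_unitarymx.
have /hermitian_normalmx/orthomx_spectralP AE := hermA.
have /mxOverP dreal := hermitian_spectral_diag_real hermA.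
pose e i := complex.Re (d 0 i).
have eE i : (e i)%:C%C = d 0 i by rewrite RRe_real // dreal.
exists P, e; split=> //.
  apply: (map_poly_inj (real_complex R)); rewrite map_char_poly -/AC AE.
  rewrite char_poly_conj ?unitarymx_unit //.
  rewrite char_poly_trig ?diag_mx_is_trig // rmorph_prod.
  apply: eq_bigr => i _; rewrite mxE eqxx mulr1n rmorphB /= map_polyX map_polyC /=.
  by rewrite eE.
move=> c z; apply: (@complexI R).
rewrite -hermitian_form_ReIm; last by rewrite linearB /= symA tr_scalar_mx.
rewrite map_mxB map_scalar_mx -/AC AE invmx_unitary //.
have -> : (toC c)%:M = P^t* *m (toC c)%:M *m P.
  by rewrite scalar_mxC -mulmxA -invmx_unitary // mulVmx ?mulmx1 // unitarymx_unit.
rewrite -mulmxBl -mulmxBr !mulmxA.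
have -> : z *m P^t* *m (diag_mx d - (toC c)%:M) *m P *m z^t*
        = (z *m P^t*) *m (diag_mx d - (toC c)%:M) *m (z *m P^t*)^t*.
  by rewrite trmx_mul map_mxM /= -/(P^t*^t*) trmxCK !mulmxA.
rewrite -[X in _ - X]diag_const_mx -linearB /= mul_mx_diag mxE.
rewrite rmorph_sum; apply: eq_bigr => i _; rewrite rmorphM /= add_Re2_Im2.
by rewrite !mxE -eE -rmorphB /= mulrAC -normCK mulrC.
Qed.

Lemma normc2_eq0 (z : R[i]) :
  (complex.Re z ^+ 2 + complex.Im z ^+ 2 == 0) = (z == 0).
Proof. by rewrite eq_complex paddr_eq0 ?sqr_ge0 // !sqrf_eq0. Qed.

Lemma normc2_ge0 (z : R[i]) : 0 <= complex.Re z ^+ 2 + complex.Im z ^+ 2.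
Proof. by rewrite addr_ge0 ?sqr_ge0. Qed.

Lemma count_enum_ord (e : 'I_n -> R) c :
  count (>= c) [seq e i | i <- enum 'I_n] = #|[pred i | c <= e i]|.
Proof. by rewrite count_map -size_filter cardE enumT. Qed.

(** At most one eigenvalue reaches [c], so some nontrivial combination a x + b y has no component
    along its eigenvector and the form is at most 0 there. By orthogonality the form is also |a|^2 B
    x x + |b|^2 B y y, which forces a = 0 and then b y = 0. *)
Lemma second_eigenvalue_gt A c x y : A^T = A -> (1 < n)%N ->
  let B := bilin (A - c%:M) in
  (eigenvalues A)`_1 < c -> 0 < B x x -> B x y = 0 -> 0 <= B y y -> y = 0.
Proof.
move=> symA n1 B; have symAc : (A - c%:M)^T = A - c%:M.
  by rewrite linearB /= symA tr_scalar_mx.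
have [P [e [uP pE /(_ c) formE]]] := sym_diagonalization symA.
rewrite (second_eigenvalue_lt (s := [seq e i | i <- enum 'I_n])); first last.
- by rewrite big_map big_enum.
- by rewrite size_map size_enum_ord.
rewrite count_enum_ord => /card_le1P le1 Bx Bxy By.
have [i0 lt_e] : exists i0, forall i, i != i0 -> e i < c.
  have [i0 i0in|none] := pickP [pred i | c <= e i].
    exists i0 => i; apply: contra_neqT; rewrite -leNgt => iin.
    by have := le1 i0 i0in i; rewrite !inE iin => /esym/eqP.
  exists (Ordinal (ltnW n1)) => i _; rewrite ltNge; exact/negbT/none.
pose u := (map_mx toC x *m P^t*) 0 i0; pose v := (map_mx toC y *m P^t*) 0 i0.
(* The coordinates [u] and [v] are complex, so the coefficients must be complex too. *)
have [a [b [ab0 abu]]] : exists a b, (a != 0) || (b != 0) /\ a * u + b * v = 0.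
  have [u0|u0] := eqVneq u 0; last first.
    by exists v, (- u); rewrite oppr_eq0 u0 orbT mulrC mulNr addrN.
  by exists 1, 0; rewrite oner_eq0 u0 mulr0 mul0r addr0.
pose z := a *: map_mx toC x + b *: map_mx toC y.
have ReE : ReM z = complex.Re a *: x + complex.Re b *: y.
  by apply/rowP => j; rewrite !mxE raddfD /=; case: a b {ab0 abu z} => ? ? [? ?]; simpc.
have ImE : ImM z = complex.Im a *: x + complex.Im b *: y.
  by apply/rowP => j; rewrite !mxE raddfD /=; case: a b {ab0 abu z ReE} => ? ? [? ?]; simpc.
pose t i := (z *m P^t*) 0 i.
have t0 : t i0 = 0 by rewrite /t mulmxDl -!scalemxAl mxE [X in X + _]mxE [X in _ + X]mxE.
have := formE z; rewrite ReE ImE !bilin_comb // -/B Bxy !mulr0 !mul0rn !addr0.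
rewrite -/(B x x).
set S := \sum_i _.
have leS i : 0 <= - ((e i - c) * (complex.Re (t i) ^+ 2 + complex.Im (t i) ^+ 2)).
  rewrite -mulNr opprB; have [->|/lt_e/ltW ei] := eqVneq i i0.
    by rewrite t0 /= expr0n /= addr0 mulr0.
  by rewrite mulr_ge0 ?normc2_ge0 ?subr_ge0.
have S_ge0 : 0 <= - S by rewrite -sumrN sumr_ge0.
move=> SE.
have {SE} SE : S = (complex.Re a ^+ 2 + complex.Im a ^+ 2) * B x x
         + (complex.Re b ^+ 2 + complex.Im b ^+ 2) * B y y by rewrite -SE; ring.
have aBx := mulr_ge0 (normc2_ge0 a) (ltW Bx).
have bBy := mulr_ge0 (normc2_ge0 b) By.
have a0 : a = 0.
  apply/eqP; rewrite -normc2_eq0.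
  have : (complex.Re a ^+ 2 + complex.Im a ^+ 2) * B x x == 0 by apply/eqP; lra.
  by rewrite mulf_eq0 (gt_eqF Bx) orbF.
have S0 : - S == 0 by apply/eqP; lra.
have z0 : z = 0.
  have unitP : P^t* \in unitmx by rewrite -invmx_unitary ?unitmx_inv ?unitarymx_unit.
  apply: (can_inj (mulmxK unitP)); rewrite mul0mx; apply/rowP => i; rewrite [RHS]mxE.
  have [->//|/lt_e ei] := eqVneq i i0.
  move: S0; rewrite -sumrN psumr_eq0 => [/allP/(_ i)|//].
  rewrite mem_index_enum => /(_ isT) /=.
  rewrite oppr_eq0 mulf_eq0 subr_eq0 (lt_eqF ei) /= => t_eq0.
  by apply/eqP; rewrite -normc2_eq0.
have b0 : b != 0 by move: ab0; rewrite a0 eqxx.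
move/eqP: z0; rewrite /z a0 scale0r add0r scaler_eq0 (negPf b0) /= => /eqP y0.
by apply/rowP => j; move/rowP/(_ j): y0; rewrite !mxE => -[].
Qed.

(** Two eigenvalues that reach [c] would give a complex plane on which the form is nonnegative. It
    contains a nonzero [z] orthogonal to [w]; as [w] is real, both parts of [z] lie in the
    hyperplane, where the form is negative off 0. *)
Lemma second_eigenvalue_lt_hyperplane A c (w : 'rV[R]_n) : A^T = A -> (1 < n)%N ->
  (forall x : 'rV[R]_n, x != 0 -> (x *m w^T) 0 0 = 0 -> bilin (A - c%:M) x x < 0) ->
  (eigenvalues A)`_1 < c.
Proof.
move=> symA n1 negB.
have [P [e [uP pE /(_ c) formE]]] := sym_diagonalization symA.
rewrite (second_eigenvalue_lt (s := [seq e i | i <- enum 'I_n])); first last.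
- by rewrite big_map big_enum.
- by rewrite size_map size_enum_ord.
rewrite count_enum_ord leqNgt; apply/negP => /card_gt1P[i [j [ei ej ij]]].
pose u := (row i P *m map_mx toC w^T) 0 0; pose v := (row j P *m map_mx toC w^T) 0 0.
have [a [b [ab0 abu]]] : exists a b, (a != 0) || (b != 0) /\ a * u + b * v = 0.
  have [u0|u0] := eqVneq u 0; last first.
    by exists v, (- u); rewrite oppr_eq0 u0 orbT mulrC mulNr addrN.
  by exists 1, 0; rewrite oner_eq0 u0 mulr0 mul0r addr0.
(* [t] holds the coordinates of [z] in the eigenbasis, supported on [i] and [j]. *)
pose t : 'rV[R[i]]_n := a *: delta_mx 0 i + b *: delta_mx 0 j.
pose z := t *m P.
have tE k : t 0 k = a * (k == i)%:R + b * (k == j)%:R by rewrite !mxE eqxx.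
have zP : z *m P^t* = t by rewrite -mulmxA (unitarymxP _) ?mulmx1.
have zw : (z *m map_mx toC w^T) 0 0 = 0.
  by rewrite /z mulmxDl -!scalemxAl -!rowE mulmxDl -!scalemxAl mxE [X in X + _]mxE [X in _ + X]mxE.
have zwE : (z *m map_mx toC w^T) 0 0
         = ((ReM z *m w^T) 0 0)%:C%C + 'i%C * ((ImM z *m w^T) 0 0)%:C%C.
  rewrite !mxE !rmorph_sum mulr_sumr -big_split; apply: eq_bigr => k _ /=.
  by rewrite !mxE !rmorphM /= mulrA -mulrDl -complexE.
have [Rew Imw] : (ReM z *m w^T) 0 0 = 0 /\ (ImM z *m w^T) 0 0 = 0.
  move: zw; rewrite zwE; set p := (_ *m _) 0 0; set q := (_ *m _) 0 0.
  by move/eqP; rewrite eq_complex /=; simpc => /andP[/eqP-> /eqP->].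
have z0 : z != 0.
  apply: contraTneq ab0 => z0; move: zP; rewrite z0 mul0mx => /rowP t0.
  have := t0 i; have := t0 j; rewrite !tE !mxE !eqxx eq_sym (negPf ij).
  by rewrite !mulr1 !mulr0 add0r addr0 => -> ->; rewrite eqxx.
have form_ge0 : 0 <= bilin (A - c%:M) (ReM z) (ReM z) + bilin (A - c%:M) (ImM z) (ImM z).
  rewrite formE zP sumr_ge0 // => k _.
  have [->|ki] := eqVneq k i; first by rewrite mulr_ge0 ?normc2_ge0 ?subr_ge0.
  have [->|kj] := eqVneq k j; first by rewrite mulr_ge0 ?normc2_ge0 ?subr_ge0.
  by rewrite tE (negPf ki) (negPf kj) !mulr0 addr0 /= expr0n /= addr0 mulr0.
have negB' x : (x *m w^T) 0 0 = 0 -> bilin (A - c%:M) x x <= 0 ?= iff (x == 0).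
  move=> xw; split; last first.
    have [->|x0] := eqVneq x 0; first by rewrite /bilin mul0mx mul0mx mxE eqxx.
    by rewrite lt_eqF ?negB.
  have [->|x0] := eqVneq x 0; first by rewrite /bilin mul0mx mul0mx mxE.
  by rewrite ltW ?negB.
have [leR eqR] := negB' _ Rew; have [leI eqI] := negB' _ Imw.
case/negP: z0; apply/eqP/rowP => k; clear formE zP zwE; clearbody z.
have /eqP/rowP/(_ k) : ReM z == 0 by rewrite -eqR; apply/eqP; lra.
have /eqP/rowP/(_ k) : ImM z == 0 by rewrite -eqI; apply/eqP; lra.
by rewrite !mxE; case: (z 0 k) => ? ? /= -> ->.
Qed.

End RealQuadraticForm.

(** * The distance form in diameter 2 *)

Lemma dist0P (G : sgraph) (u v : G) : connect adj u v -> (dist u v == 0%N) = (u == v).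
Proof.
move=> uv; have [p [_ pl _ ps]] := dist_path uv.
have [uv_eq|uv_neq] := eqVneq u v.
  by rewrite -leqn0 (dist_le (p := [::])).
by apply: contra_neqF uv_neq => /eqP d0; case: p pl ps => //= ? ? _; rewrite d0.
Qed.

Lemma dist1P (G : sgraph) (u v : G) : connect adj u v -> (dist u v == 1%N) = adj u v.
Proof.
move=> uv; have [uv_eq|uv_neq] := eqVneq u v.
  have := dist0P uv; rewrite uv_eq eqxx => /eqP->.
  by rewrite adj_irrefl.
apply/idP/idP => [|adj_uv].
  have [p [pp pl _ <-]] := dist_path uv.
  by case: p pp pl => [|x []] //=; rewrite andbT => + <-.
rewrite eqn_leq lt0n dist0P // uv_neq andbT.
by rewrite (dist_le (p := [:: v])) //= adj_uv.
Qed.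

Lemma dist_diameter2 (G : sgraph) (u v : G) : connected G -> diameter G = 2%N ->
  dist u v = if u == v then 0%N else if adj u v then 1%N else 2%N.
Proof.
case/andP => _ /forallP/(_ u)/forallP/(_ v) uv Gdiam.
have : (dist u v <= 2)%N.
  rewrite -Gdiam; apply: leq_trans (leq_bigmax u).
  exact: (leq_bigmax (F := fun v => dist u v)).
have := dist0P uv; have := dist1P uv.
by case: (dist u v) => [|[|[|]]] //= <- <-.
Qed.

Section DistanceForm.
Variables (R : rcfType) (G : sgraph).
Implicit Types (u v : G) (f g : G -> R).

(** The entries of D + I/2 in diameter 2. Written without [dist], they make sense on every graph and
    are preserved by induced embeddings. *)
Definition shifted_dist u v : R := 2 - 3 / 2 * (u == v)%:R - (adj u v)%:R.

Definition dist_form f g : R := \sum_u \sum_v f u * g v * shifted_dist u v.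

Hypotheses (Gconn : connected G) (Gdiam : diameter G = 2%N).

Let D := distance_mx R G.

Lemma distance_mx_sym : D^T = D.
Proof.
apply/matrixP => i j; rewrite !mxE !dist_diameter2 // eq_sym.
by rewrite adj_sym.
Qed.

Lemma card_diameter2 : (1 < #|G|)%N.
Proof.
rewrite ltnNge; apply/negP => /card_le1P G1; move: Gdiam.
rewrite /diameter big1 // => u _; rewrite big1 // => v _.
rewrite dist_diameter2 //; have /(_ v) := G1 u isT.
by rewrite !inE eq_sym => <-.
Qed.

Lemma sum_vertices (F : G -> R) : \sum_u F u = \sum_(i < #|G|) F (enum_val i).
Proof. exact/reindex/onW_bij/enum_val_bij. Qed.

Definition vertex_row f : 'rV[R]_#|G| := \row_i f (enum_val i).

Lemma bilin_distance_mx f g :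
  bilin (D - (- (1 / 2))%:M) (vertex_row f) (vertex_row g) = dist_form f g.
Proof.
rewrite /bilin /dist_form exchange_big sum_vertices mxE /=.
apply: eq_bigr => j _; rewrite mxE mulr_suml.
rewrite sum_vertices; apply: eq_bigr => i _.
rewrite !mxE dist_diameter2 // /shifted_dist (inj_eq enum_val_inj).
case: eqVneq => [->|_]; rewrite ?adj_irrefl /=; last case: adj => /=;
  by rewrite ?mulr1n ?mulr0n; field.
Qed.

Lemma dist_form_degenerate f g : dist_eigenvalue R G 2 < - (1 / 2) ->
  0 < dist_form f f -> dist_form f g = 0 -> 0 <= dist_form g g ->
  forall u, g u = 0.
Proof.
rewrite -!bilin_distance_mx => l2 ff fg gg u.
have /rowP/(_ (enum_rank u)) :=
  second_eigenvalue_gt distance_mx_sym card_diameter2 l2 ff fg gg.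
by rewrite !mxE enum_rankK.
Qed.

Lemma second_dist_eigenvalue_lt (w : G -> R) :
  (forall f, (exists u, f u != 0) -> \sum_u f u * w u = 0 -> dist_form f f < 0) ->
  dist_eigenvalue R G 2 < - (1 / 2).
Proof.
move=> neg; apply: (second_eigenvalue_lt_hyperplane (w := vertex_row w)).
- exact: distance_mx_sym.
- exact: card_diameter2.
move=> x x0 xw; pose f u := x 0 (enum_rank u).
have xE : x = vertex_row f by apply/rowP => i; rewrite mxE /f enum_valK.
rewrite xE bilin_distance_mx neg //.
  have /rV0Pn[i xi] := x0.
  by exists (enum_val i); rewrite /f enum_valK.
rewrite sum_vertices -[RHS]xw mxE; apply: eq_bigr => i _.
by rewrite xE !mxE /f.
Qed.

Definition combination (l : seq (G * R)) u : R := \sum_(p <- l) p.2 * (u == p.1)%:R.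

(** Bilinearity reduces the sum over all vertices to one over two short lists, which [lra] can
    evaluate. *)
Lemma dist_form_combination (l l' : seq (G * R)) :
  dist_form (combination l) (combination l')
  = \sum_(p <- l) \sum_(q <- l') p.2 * q.2 * shifted_dist p.1 q.1.
Proof.
have delta (c : R) x (F : G -> R) : \sum_u c * (u == x)%:R * F u = c * F x.
  rewrite (bigD1 x) //= eqxx mulr1 big1 ?addr0 // => u /negPf->.
  by rewrite mulr0 mul0r.
have sum_comb (s : seq (G * R)) (F : G -> R) :
    \sum_u combination s u * F u = \sum_(p <- s) p.2 * F p.1.
  under eq_bigr => u _ do rewrite mulr_suml.
  by rewrite exchange_big; apply: eq_bigr => p _; rewrite /= delta.
rewrite /dist_form.
under eq_bigr => u _ do
  (under eq_bigr => v _ do rewrite -mulrA; rewrite -mulr_sumr sum_comb).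
rewrite sum_comb; apply: eq_bigr => p _; rewrite mulr_sumr.
by apply: eq_bigr => q _; rewrite mulrA.
Qed.
End DistanceForm.

(** * Forbidden induced subgraphs *)

Lemma adj_neq (G : sgraph) (u v : G) : adj u v -> u != v.
Proof. by apply: contraTneq => ->; rewrite adj_irrefl. Qed.

Section Forbidden.
Variables (R : rcfType) (G : sgraph).
Implicit Types (u v a b c d x y z : G).

Local Notation sd := (@shifted_dist R G).

Lemma shifted_dist_diag u : sd u u = 1 / 2.
Proof. by rewrite /shifted_dist eqxx adj_irrefl /=; lra. Qed.

Lemma shifted_dist_adj u v : adj u v -> (sd u v = 1) * (sd v u = 1).
Proof.
move=> uv; have := adj_neq uv; rewrite /shifted_dist [adj v u]adj_sym uv eq_sym.
by move=> /negPf->; split; rewrite /=; lra.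
Qed.

Lemma shifted_dist_nadj u v : u != v -> ~~ adj u v -> (sd u v = 2) * (sd v u = 2).
Proof.
move=> uv nuv; rewrite /shifted_dist [adj v u]adj_sym (negPf nuv) [v == u]eq_sym.
by rewrite (negPf uv); split; rewrite /=; lra.
Qed.

Hypotheses (Gconn : connected G) (Gdiam : diameter G = 2%N).
Hypothesis (l2 : dist_eigenvalue R G 2 < - (1 / 2)).

(* A list of weighted vertices stands for the vector [combination l]. *)
Let form (l l' : seq (G * R)) : R :=
  \sum_(p <- l) \sum_(q <- l') p.2 * q.2 * sd p.1 q.1.

(** As [a] does not recur in [t], the second vector has coordinate [c] at [a]. Applied with a
    nonzero constant [c], this gives the contradiction that excludes a subgraph. *)
Lemma combination_degenerate l a (c : R) t : a \notin unzip1 t ->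
  0 < form l l -> form l ((a, c) :: t) = 0 ->
  0 <= form ((a, c) :: t) ((a, c) :: t) -> c = 0.
Proof.
rewrite /form -!dist_form_combination => a_t ll lt tt.
have := dist_form_degenerate Gconn Gdiam l2 ll lt tt a.
rewrite /combination big_cons /= eqxx mulr1 big_seq big1 ?addr0 // => p pt.
by have [ap|_] := eqVneq a p.1; rewrite ?mulr0 //; case/negP: a_t; rewrite ap map_f.
Qed.

(* A violation makes a, x, y, b an induced C_4 or P_4, and the all-ones vector is
   orthogonal to the second vector used in each case. *)
Lemma adj_nbhd_nested x y a b : adj x y -> adj a x -> adj b y ->
  a != y -> b != x -> adj a y || adj b x.
Proof.
move=> xy ax yb ay bx; apply/norP => -[nay nbx].
have ab : a != b by apply: contraNneq nay => ->.
have yx : adj y b by rewrite adj_sym.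
have [ax' xy' yb' xb] := And4 (adj_neq ax) (adj_neq xy) (adj_neq yb) bx.
have [cab|nab] := boolP (adj a b).
  suff /eqP : (1 : R) = 0 by rewrite oner_eq0.
  (* On C_4 the alternating vector has sum 0 and adjacency eigenvalue -2, so the form is 1/2 times
     its squared norm. *)
  apply: (combination_degenerate (l := [:: (a, 1); (x, 1); (y, 1); (b, 1)])
            (a := a) (t := [:: (x, -1); (y, 1); (b, -1)]));
    rewrite /= ?inE ?negb_or ?ax' ?ay ?ab // /form !big_cons !big_nil /=;
  rewrite !(shifted_dist_diag, shifted_dist_adj xy, shifted_dist_adj ax,
    shifted_dist_adj yb, shifted_dist_nadj ay nay, shifted_dist_nadj bx nbx,
    shifted_dist_adj cab); lra.
suff /eqP : (1 : R) = 0 by rewrite oner_eq0.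
(* On P_4 the weights 1, -2, 2, -1 have sum 0 and approximate the eigenvector for the least
   eigenvalue; the form equals 1. *)
apply: (combination_degenerate (l := [:: (a, 1); (x, 1); (y, 1); (b, 1)])
            (a := a) (t := [:: (x, -2); (y, 2); (b, -1)]));
    rewrite /= ?inE ?negb_or ?ax' ?ay ?ab // /form !big_cons !big_nil /=;
  rewrite !(shifted_dist_diag, shifted_dist_adj xy, shifted_dist_adj ax,
    shifted_dist_adj yb, shifted_dist_nadj ay nay, shifted_dist_nadj bx nbx,
    shifted_dist_nadj ab nab); lra.
Qed.

(** * Subgraphs excluded in the complement of a universal vertex *)

Section Universal.
Variable v : G.
Hypothesis vU : forall u, u != v -> adj v u.

(* If z is a vector off v with z^T (A + 3/2 I) z <= 0 and sum s, then z - 2 s e_v is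
   orthogonal to e_v and the form is nonnegative on it; the weights below are such z,
   close to the eigenvectors for the least eigenvalue, completed in this way. *)
Lemma no_claw c x y z : adj c x -> adj c y -> adj c z ->
  x != y -> y != z -> x != z -> c != v -> x != v -> y != v -> z != v ->
  [|| adj x y, adj y z | adj x z].
Proof.
move=> cx cy cz xy yz xz /vU vc /vU vx /vU vy /vU vz.
apply/norP => -[nxy /norP[nyz nxz]].
suff /eqP : (1 : R) = 0 by rewrite oner_eq0.
apply: (combination_degenerate (l := [:: (v, 1)])
            (a := x) (t := [:: (c, -2); (v, -2); (y, 1); (z, 1)]));
  rewrite /= ?inE ?negb_or ?xy ?xz ?[x == c]eq_sym ?[x == v]eq_sym ?adj_neq //
    /form !big_cons !big_nil /=;
  rewrite !(shifted_dist_diag, shifted_dist_adj vc, shifted_dist_adj vx,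
    shifted_dist_adj vy, shifted_dist_adj vz, shifted_dist_adj cx,
    shifted_dist_adj cy, shifted_dist_adj cz, shifted_dist_nadj xy nxy,
    shifted_dist_nadj yz nyz, shifted_dist_nadj xz nxz); lra.
Qed.

Lemma no_diamond a b x y : adj a b -> adj a x -> adj a y -> adj b x -> adj b y ->
  x != y -> a != v -> b != v -> x != v -> y != v -> adj x y.
Proof.
move=> ab ax ay bx by_ xy /vU va /vU vb /vU vx /vU vy.
have [//|nxy] := boolP (adj x y).
suff /eqP : (1 : R) = 0 by rewrite oner_eq0.
(* These weights have sum 0, so [v] gets no correction; the form is exactly 0. *)
apply: (combination_degenerate (l := [:: (v, 1)])
            (a := x) (t := [:: (y, 1); (a, -1); (b, -1)]));
  rewrite /= ?inE ?negb_or ?xy ?[x == a]eq_sym ?[x == b]eq_sym ?adj_neq //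
    /form !big_cons !big_nil /=;
  rewrite !(shifted_dist_diag, shifted_dist_adj va, shifted_dist_adj vb,
    shifted_dist_adj vx, shifted_dist_adj vy, shifted_dist_adj ab,
    shifted_dist_adj ax, shifted_dist_adj ay, shifted_dist_adj bx,
    shifted_dist_adj by_, shifted_dist_nadj xy nxy); lra.
Qed.

Lemma no_butterfly c x y z w : adj c x -> adj c y -> adj c z -> adj c w ->
  adj x y -> adj z w -> x != z -> x != w -> y != z -> y != w ->
  c != v -> x != v -> y != v -> z != v -> w != v ->
  [|| adj x z, adj x w, adj y z | adj y w].
Proof.
move=> cx cy cz cw xy zw xz xw yz yw /vU vc /vU vx /vU vy /vU vz /vU vw.
apply/norP => -[nxz /norP[nxw /norP[nyz nyw]]].
suff /eqP : (1 : R) = 0 by rewrite oner_eq0.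
apply: (combination_degenerate (l := [:: (v, 1)])
            (a := x) (t := [:: (c, -2); (v, -4); (y, 1); (z, 1); (w, 1)]));
  rewrite /= ?inE ?negb_or ?xz ?xw ?[x == c]eq_sym ?[x == v]eq_sym ?adj_neq //
    /form !big_cons !big_nil /=;
  rewrite !(shifted_dist_diag, shifted_dist_adj vc, shifted_dist_adj vx,
    shifted_dist_adj vy, shifted_dist_adj vz, shifted_dist_adj vw, shifted_dist_adj cx,
    shifted_dist_adj cy, shifted_dist_adj cz, shifted_dist_adj cw,
    shifted_dist_adj xy, shifted_dist_adj zw, shifted_dist_nadj xz nxz,
    shifted_dist_nadj xw nxw, shifted_dist_nadj yz nyz, shifted_dist_nadj yw nyw); lra.
Qed.

Lemma no_pendant_K4 a p x y z : adj a p -> adj a x -> adj a y -> adj a z ->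
  adj x y -> adj y z -> adj x z -> p != x -> p != y -> p != z ->
  a != v -> p != v -> x != v -> y != v -> z != v ->
  [|| adj p x, adj p y | adj p z].
Proof.
move=> ap ax ay az xy yz xz px py pz /vU va /vU vp /vU vx /vU vy /vU vz.
apply/norP => -[npx /norP[npy npz]].
suff /eqP : (2 : R) = 0 by rewrite pnatr_eq0.
apply: (combination_degenerate (l := [:: (v, 1)])
            (a := p) (t := [:: (a, -3); (v, -4); (x, 1); (y, 1); (z, 1)]));
  rewrite /= ?inE ?negb_or ?px ?py ?pz ?[p == a]eq_sym ?[p == v]eq_sym ?adj_neq //
    /form !big_cons !big_nil /=;
  rewrite !(shifted_dist_diag, shifted_dist_adj va, shifted_dist_adj vx,
    shifted_dist_adj vy, shifted_dist_adj vz, shifted_dist_adj vp, shifted_dist_adj ap,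
    shifted_dist_adj ax, shifted_dist_adj ay, shifted_dist_adj az,
    shifted_dist_adj xy, shifted_dist_adj yz, shifted_dist_adj xz,
    shifted_dist_nadj px npx, shifted_dist_nadj py npy, shifted_dist_nadj pz npz); lra.
Qed.

End Universal.
End Forbidden.

(** * Structure of the graphs with second eigenvalue below -1/2 *)

(** Stated for a bare relation because it serves twice: for the whole graph and for each component
    left after deleting a universal vertex. *)
Lemma dominating_vertex (T : finType) (e : rel T) (x : T) :
  symmetric e -> irreflexive e ->
  (forall x y a b, e x y -> e a x -> e b y -> a != y -> b != x -> e a y || e b x) ->
  exists2 u, connect e x u & forall w, connect e x w -> w != u -> e u w.
Proof.
move=> sym_e irr_e nested.
pose N z := [set w | e z w].
have [u xu max_u] := @arg_maxnP _ x (connect e x) (fun z => #|N z|) (connect0 e x).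
exists u => // w xw.
(* By nestedness and maximality of the degree of u, N[y] is contained in N[u]. *)
have closed_u y z : (y == u) || e u y -> e y z -> (z == u) || e u z.
  case: eqVneq => [-> _ ->|yu /= uy yz]; first by rewrite orbT.
  have [//|zu] := eqVneq z u; apply/negPn/negP => /= nuz.
  have /max_u : connect e x y by apply: connect_trans xu (connect1 uy).
  rewrite /= leqNgt => /negP[].
  (* The left side has one element more than [N u], against the maximality of [u]. *)
  have sub : z |: (u |: N u :\ y) \subset N y.
    apply/subsetP => a; rewrite !inE => /or3P[/eqP->//|/eqP->|/andP[ay ua]].
      by rewrite sym_e.
    have := nested u y a z uy; rewrite sym_e ua sym_e yz => /(_ isT isT ay zu).
    by rewrite [e z u]sym_e (negPf nuz) orbF sym_e.
  apply: leq_trans (subset_leq_card sub).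
  rewrite !cardsU1 !inE irr_e (negPf zu) (negPf nuz) !andbF /=.
  by rewrite [in X in (X < _)%N](cardsD1 y) inE uy.
have : connect e u w by apply: connect_trans xw; rewrite sym_connect_sym.
case/connectP => p pp -> /negPf pu.
have reach z : (z == u) || e u z -> path e z p -> (last z p == u) || e u (last z p).
  elim: p z {pp pu} => //= y p IHp z uz /andP[zy]; apply: IHp.
  exact: closed_u uz zy.
by have := reach u _ pp; rewrite eqxx pu; apply.
Qed.

Lemma iso_connected (G H : sgraph) : iso G H -> connected G -> connected H.
Proof.
case=> f [g fK gK] fadj /andP[G0 /forallP Gconn]; apply/andP; split.
  by case/card_gt0P: G0 => x _; apply/card_gt0P; exists (f x).
apply/forallP => u; apply/forallP => v.
have /forallP/(_ (g v))/connectP[p pp pl] := Gconn (g u).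
apply/connectP; exists (map f p).
  rewrite -{1}[u]gK path_map; apply: sub_path pp => a b /=.
  by rewrite fadj.
by rewrite -{1}[u]gK last_map -pl gK.
Qed.

Lemma iso_induced_image (G H : sgraph) (f : G -> H) : injective f ->
  (forall u v, adj (f u) (f v) = adj u v) -> iso G (induced [set f u | u in G]).
Proof.
move=> finj fadj.
have imf u : f u \in [set f u | u in G] by apply: imset_f.
pose h u : induced [set f u | u in G] := exist _ (f u) (imf u).
exists h => [|u v]; last exact: fadj.
apply: inj_card_bij => [u v [] /finj //|].
by rewrite card_sig card_imset.
Qed.

Definition paw : sgraph := join (complete 1) (union (complete 1) (complete 2)).

Section Structure.
Variables (R : rcfType) (G : sgraph).
Hypotheses (Gconn : connected G) (Gdiam : diameter G = 2%N).
Hypothesis (l2 : dist_eigenvalue R G 2 < - (1 / 2)).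

Lemma universal_vertex : exists v : G, forall u, u != v -> adj v u.
Proof.
have /andP[/card_gt0P[x _] /forallP/(_ x)/forallP Gx] := Gconn.
have nested a b c d := @adj_nbhd_nested R G Gconn Gdiam l2 a b c d.
have [u _ uU] := dominating_vertex x (@adj_sym G) (@adj_irrefl G) nested.
by exists u => w; apply: uU.
Qed.

Variable v : G.
Hypothesis vU : forall u, u != v -> adj v u.

Definition adj_off : rel G := fun x y => [&& adj x y, x != v & y != v].

Lemma adj_off_sym : symmetric adj_off.
Proof. by move=> x y; rewrite /adj_off adj_sym [(x != v) && _]andbC. Qed.

Lemma connect_off_neq x y : x != v -> connect adj_off x y -> y != v.
Proof.
move=> xv /connectP[p pp ->]; elim: p x xv pp => //= y' p IHp x xv.
by case/andP => /and3P[_ _ yv]; apply: IHp.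
Qed.

(** The component has a dominating vertex [u]. If it is not complete, fix nonadjacent [b] and [c]:
    the excluded subgraphs leave at most one vertex besides [u], [b], [c], so the component is P_3
    or the paw, and P_3 is induced in the paw. *)
Lemma component_structure (x : G) : x != v ->
  (forall y z, connect adj_off x y -> connect adj_off x z -> y != z -> adj y z) \/
  (exists g : G -> paw, forall y z, connect adj_off x y -> connect adj_off x z ->
     adj (g y) (g z) = adj y z /\ (g y = g z -> y = z)).
Proof.
move=> xv; pose C := connect adj_off x.
have Cv y : C y -> y != v by apply: connect_off_neq.
have [u Cu uC] : exists2 u, C u & forall w, C w -> w != u -> adj u w.
  have [|a b c d|u xu uC] := @dominating_vertex G adj_off x adj_off_sym.
  - by move=> a; rewrite /adj_off adj_irrefl.
  - case/and3P => ab av bv /and3P[ca cv _] /and3P[db dv _] cb da.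
    rewrite /adj_off av bv cv dv !andbT.
    exact: (adj_nbhd_nested Gconn Gdiam l2 ab ca db cb da).
  by exists u => // w xw wu; have /and3P[] := uC w xw wu.
have [/existsP[b /existsP[c /and4P[Cb Cc bc nbc]]]|allC] :=
    boolP [exists b, exists c, [&& C b, C c, b != c & ~~ adj b c]]; last first.
  left=> y z Cy Cz yz; apply: contraNT allC => nyz.
  by apply/existsP; exists y; apply/existsP; exists z; apply/and4P.
right.
have bu : b != u by apply: contraNneq nbc => bu; rewrite bu uC // -bu eq_sym.
have cu : c != u by apply: contraNneq nbc => cu; rewrite adj_sym cu uC // -cu.
(* The claw centred at [u] gives at least one adjacency, the diamond on the edge [u], [w] at most
   one. *)
have neither w : C w -> w != u -> w != b -> w != c -> adj b w (+) adj c w.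
  move=> Cw wu wb wc.
  have := no_claw Gconn Gdiam l2 vU (uC b Cb bu) (uC c Cc cu) (uC w Cw wu) bc.
  rewrite ![_ == w]eq_sym (negPf nbc) /= => /(_ wc wb (Cv _ Cu) (Cv _ Cb) (Cv _ Cc) (Cv _ Cw)).
  case bw: (adj b w); case cw: (adj c w) => //= _.
  case/negP: nbc.
  apply: (no_diamond Gconn Gdiam l2 vU (a := u) (b := w)); rewrite ?uC ?Cv //.
    by rewrite adj_sym.
  by rewrite adj_sym.
(* Two further vertices on the side of [b'] are adjacent by the diamond, and then [u], [b'], [w],
   [w'] form a K_4 with pendant [c']. *)
have others_adj b' c' w w' : C b' -> C c' -> C w -> C w' ->
    b' != u -> c' != u -> w != u -> w' != u -> c' != b' -> c' != w -> c' != w' ->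
    adj b' w -> adj b' w' -> ~~ adj c' b' -> ~~ adj c' w -> ~~ adj c' w' -> w = w'.
  move=> Cb' Cc' Cw Cw' bu' cu' wu wu' cb' cw cw' bw bw' ncb ncw ncw'.
  apply/eqP; apply: contraT => ww'.
  have adj_ww' : adj w w'.
    by apply: (no_diamond Gconn Gdiam l2 vU (a := u) (b := b')); rewrite ?uC ?Cv.
  have := no_pendant_K4 Gconn Gdiam l2 vU (uC _ Cc' cu') (uC _ Cb' bu') (uC _ Cw wu)
    (uC _ Cw' wu') bw adj_ww' bw' cb' cw cw' (Cv _ Cu) (Cv _ Cc') (Cv _ Cb')
    (Cv _ Cw) (Cv _ Cw').
  by rewrite (negPf ncb) (negPf ncw) (negPf ncw').
(* Further vertices on opposite sides are nonadjacent by the diamond, and then form a butterfly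
   centred at [u]. *)
have others_sep w w' : C w -> C w' -> w != u -> w' != u -> w != b -> w != c ->
    w' != b -> w' != c -> adj b w -> adj c w' -> False.
  move=> Cw Cw' wu wu' wb wc wb' wc' bw cw'.
  have ncw : ~~ adj c w by have := neither w Cw wu wb wc; rewrite bw.
  have nbw' : ~~ adj b w' by have := neither w' Cw' wu' wb' wc'; rewrite cw' addbT.
  have ww' : w != w' by apply: contraNneq ncw => ->.
  have nww' : ~~ adj w w'.
    apply: contra nbw' => adj_ww'.
    apply: (no_diamond Gconn Gdiam l2 vU (a := u) (b := w)); rewrite ?uC ?Cv //.
      by rewrite adj_sym.
    by rewrite eq_sym.
  have := no_butterfly Gconn Gdiam l2 vU (uC _ Cb bu) (uC _ Cw wu) (uC _ Cc cu)
    (uC _ Cw' wu') bw cw' bc _ wc ww' (Cv _ Cu) (Cv _ Cb) (Cv _ Cw) (Cv _ Cc) (Cv _ Cw').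
  by rewrite eq_sym wb' [adj w c]adj_sym (negPf nbc) (negPf nbw')
    (negPf ncw) (negPf nww') => /(_ isT).
(* [c'] becomes the pendant vertex and [b'] a triangle vertex; [ord_max] receives the single
   possible further vertex. *)
have embed b' c' : C b' -> C c' -> b' != u -> c' != u -> b' != c' -> ~~ adj b' c' ->
    (forall w, C w -> w != u -> w != b' -> w != c' -> adj b' w && ~~ adj c' w) ->
    exists g : G -> paw, forall y z, C y -> C z ->
     adj (g y) (g z) = adj y z /\ (g y = g z -> y = z).
  move=> Cb' Cc' bu' cu' bc' nbc' other.
  pose g y : paw := if y == u then inl ord0 else
    inr (if y == c' then inl ord0 else inr (if y == b' then ord0 else ord_max)).
  exists g => y z Cy Cz; rewrite /g.
  have sym_case : forall y z, C y -> C z -> adj y z = adj z y by move=> *; rewrite adj_sym.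
  have [->|yu] := eqVneq y u; have [->|zu] := eqVneq z u.
  - by rewrite !adj_irrefl.
  - by rewrite uC.
  - by rewrite adj_sym [RHS]adj_sym uC.
  have [->|yc] := eqVneq y c'; have [->|zc] := eqVneq z c'.
  - by rewrite !adj_irrefl.
  - split=> //=; symmetry; apply/negbTE.
    have [->|zb] := eqVneq z b'; first by rewrite adj_sym.
    by have /andP[] := other z Cz zu zb zc.
  - split=> //=; symmetry; apply/negbTE; rewrite adj_sym.
    have [->|yb] := eqVneq y b'; first by rewrite adj_sym.
    by have /andP[] := other y Cy yu yb yc.
  have [->|yb] := eqVneq y b'; have [->|zb] := eqVneq z b'.
  - by rewrite !adj_irrefl.
  - by have /andP[-> _] := other z Cz zu zb zc.
  - by rewrite [RHS]adj_sym; have /andP[-> _] := other y Cy yu yb yc.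
  have /andP[by_ ncy] := other y Cy yu yb yc; have /andP[bz ncz] := other z Cz zu zb zc.
  have <- : y = z.
    apply: (others_adj b' c'); rewrite // 1?eq_sym //.
    by rewrite adj_sym.
  by rewrite !adj_irrefl.
(* The triangle vertex is [b] if a further vertex is adjacent to it, and [c] otherwise. *)
have [w /and5P[Cw wu wb wc bw]|none] :=
    pickP [pred w | [&& C w, w != u, w != b, w != c & adj b w]].
  apply: (embed b c) => // w' Cw' wu' wb' wc'.
  have := neither w' Cw' wu' wb' wc'; have [cw'|_ /=] := boolP (adj c w');
    last by rewrite addbF => ->.
  by case: (others_sep w w').
have cb : c != b by rewrite eq_sym.
have ncb : ~~ adj c b by rewrite adj_sym.
apply: (embed c b) => // w' Cw' wu' wc' wb'.
have := neither w' Cw' wu' wb' wc'; have := none w'; rewrite /= Cw' wu' wb' wc' /= => ->.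
by rewrite andbT.
Qed.
End Structure.

(** * Embedding into a relaxed block star graph *)

Section BigUnionInjection.
Variables (I : finType) (F : I -> sgraph).

Definition big_inj i (x : F i) : big_union F := Tagged (fun i => vertex (F i)) x.

Lemma big_inj_adj i (x y : F i) : adj (big_inj x) (big_inj y) = adj x y.
Proof. by rewrite /= /big_union_adj /= eqxx tagged_asE. Qed.

Lemma big_inj_adjN i j (x : F i) (y : F j) : i != j ->
  adj (big_inj x) (big_inj y) = false.
Proof. by move=> /negPf ij; rewrite /= /big_union_adj /= ij. Qed.

End BigUnionInjection.

Section Embedding.
Variables (R : rcfType) (G : sgraph).
Hypotheses (Gconn : connected G) (Gdiam : diameter G = 2%N).
Hypothesis (l2 : dist_eigenvalue R G 2 < - (1 / 2)).

Let n := #|G|.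

(** The universal vertex goes to the apex. Each remaining component gets its own copy of K_n or of
    the paw; n copies of each leave room for all components. *)
Lemma relaxed_block_star_embedding :
  exists f : G -> relaxed_block_star (fun _ : 'I_1 => n) (fun _ => n) n n,
    injective f /\ forall x y, adj (f x) (f y) = adj x y.
Proof.
have [v vU] := universal_vertex Gconn Gdiam l2.
have csym := sym_connect_sym (@adj_off_sym G v).
pose comp (x : G) := connect (adj_off v) x.
pose good x (gx : G -> paw) := x != v ->
    (forall y z, comp x y -> comp x z -> y != z -> adj y z) \/
    (forall y z, comp x y -> comp x z -> adj (gx y) (gx z) = adj y z /\ (gx y = gx z -> y = z)).
(* One map per vertex is chosen at once; at [v] and in complete components it is a dummy. *)
have [g gP] : exists g : G -> G -> paw, forall x, good x (g x).
  apply: fin_all_exists => x.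
  have [->|xv] := eqVneq x v; first by exists (fun=> inl ord0); rewrite /good eqxx.
  have [Kx|[gx gxP]] := component_structure Gconn Gdiam l2 vU xv.
    by exists (fun=> inl ord0) => _; left.
  by exists gx => _; right.
(* The root represents the component, so all its vertices share the same copy, the same map and the
   same case of [is_complete]. *)
pose rt := fingraph.root (adj_off v).
pose is_complete x := [forall y, forall z, [&& comp x y, comp x z & y != z] ==> adj y z].
pose K x : copies n (complete n) := @big_inj _ (fun=> complete n) (enum_rank (rt x)) (enum_rank x).
pose f x : relaxed_block_star (fun _ : 'I_1 => n) (fun _ => n) n n :=
  if x == v then inl ord0 else inr (inl (
    if is_complete (rt x) then inl (@big_inj _ (fun=> copies n (complete n)) ord0 (K x))
    else inr (@big_inj _ (fun=> paw) (enum_rank (rt x)) (g (rt x) x)))).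
suff fP x y : adj (f x) (f y) = adj x y /\ (f x = f y -> x = y).
  by exists f; split=> [x y|x y]; case: (fP x y).
rewrite /f; have [->|xv] := eqVneq x v; have [->|yv] := eqVneq y v.
- by rewrite !adj_irrefl.
- by rewrite vU.
- by rewrite [RHS]adj_sym vU.
have rtv : rt x != v by apply: connect_off_neq xv (connect_root _ _).
have in_comp z : comp (rt z) z by rewrite /comp csym connect_root.
have [rxy|rxy] := eqVneq (rt x) (rt y); last first.
  have -> : adj x y = false.
    apply: contraNF rxy => xy; apply/eqP/(fingraph.rootP csym)/connect1.
    by rewrite /adj_off xy xv.
  have rxy' : enum_rank (rt x) != enum_rank (rt y) by rewrite (inj_eq enum_rank_inj).
  do 2![case: ifP => _]; split=> //.
  - by rewrite [LHS]big_inj_adj [LHS]big_inj_adjN.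
  - by case=> /eqP; rewrite (negPf rxy').
  - by rewrite [LHS]big_inj_adjN.
  - by case=> /eqP; rewrite (negPf rxy').
rewrite /K -rxy; case: ifP => [/forallP/(_ x)/forallP/(_ y)|].
  rewrite in_comp rxy in_comp !andTb => Kxy; split; last first.
    by case; apply: enum_rank_inj.
  rewrite [LHS]big_inj_adj [LHS]big_inj_adj /= /complete_adj (inj_eq enum_rank_inj).
  by have [->|/(implyP Kxy)->] := eqVneq x y; rewrite ?adj_irrefl.
move=> nK; have [Kx|/(_ x y (in_comp x))] := gP _ rtv.
  case/negP: nK; apply/forallP => y'; apply/forallP => z; apply/implyP => /and3P[].
  exact: Kx.
rewrite rxy => /(_ (in_comp y))[gadj ginj]; split.
  by rewrite [LHS]big_inj_adj.
by case; apply: ginj.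
Qed.
End Embedding.

(** * Relaxed block star graphs *)

Section PositiveDefinite.
Variable R : rcfType.

(** The quadratic form of A_H + 3/2 I. *)
Definition adj_form (H : sgraph) (y : H -> R) : R :=
  \sum_u (3 / 2 * y u ^+ 2 + \sum_v (adj u v)%:R * (y u * y v)).

Definition pos_def (H : sgraph) := forall y : H -> R,
  0 <= adj_form y /\ (adj_form y = 0 -> forall u, y u = 0).

(** The adjacency matrix is block diagonal, so the form is a sum of two. *)
Lemma pos_def_union (G H : sgraph) : pos_def G -> pos_def H -> pos_def (union G H).
Proof.
move=> pG pH y.
have -> : adj_form y = adj_form (y \o inl) + adj_form (y \o inr).
  rewrite /adj_form big_sumType /=; congr (_ + _); apply: eq_bigr => u _;
    rewrite big_sumType /=; congr (_ + _); [rewrite [X in _ + X]big1|rewrite [X in X + _]big1];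
    by rewrite ?addr0 ?add0r // => v _; rewrite mul0r.
have [G0 Geq] := pG (y \o inl); have [H0 Heq] := pH (y \o inr).
split=> [|/eqP]; first exact: addr_ge0.
by rewrite paddr_eq0 // => /andP[/eqP/Geq Gy /eqP/Heq Hy] [u|u]; [apply: Gy|apply: Hy].
Qed.

Lemma sum_big_union (I : finType) (F : I -> sgraph) (f : big_union F -> R) :
  \sum_p f p = \sum_i \sum_(x : F i) f (big_inj x).
Proof. by rewrite sig_big_dep; apply: eq_bigr => -[]. Qed.

Lemma pos_def_big_union (I : finType) (F : I -> sgraph) :
  (forall i, pos_def (F i)) -> pos_def (big_union F).
Proof.
move=> pF y.
have -> : adj_form y = \sum_i adj_form (y \o @big_inj I F i).
  rewrite /adj_form sum_big_union; apply: eq_bigr => i _.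
  apply: eq_bigr => x _; rewrite sum_big_union (bigD1 i) //=; congr (_ + _).
  rewrite [X in _ + X]big1 ?addr0 => [|j ji].
    by apply: eq_bigr => z _; rewrite [big_union_adj _ _]big_inj_adj.
  by rewrite big1 // => z _; rewrite [big_union_adj _ _]big_inj_adjN ?mul0r // eq_sym.
have F0 i : 0 <= adj_form (y \o @big_inj I F i) by case: (pF i (y \o @big_inj I F i)).
split=> [|/eqP]; first by apply: sumr_ge0.
rewrite psumr_eq0 // => /allP Fy [i x].
have /= := Fy i; rewrite mem_index_enum => /(_ isT)/eqP.
by case: (pF i (y \o @big_inj I F i)) => _ /[apply]; apply.
Qed.

(** Here A = J - I, so A + 3/2 I = J + I/2. *)
Lemma pos_def_complete n : pos_def (complete n).
Proof.
move=> y.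
have -> : adj_form y = 1 / 2 * (\sum_u y u ^+ 2) + (\sum_u y u) ^+ 2.
  rewrite /adj_form expr2 mulr_suml mulr_sumr -big_split; apply: eq_bigr => u _ /=.
  rewrite mulr_sumr (bigD1 u) //= /complete_adj eqxx mul0r add0r [in RHS](bigD1 u) //=.
  set S := \sum_(_ | _) _; set T := \sum_(_ | _) _.
  have -> : S = T by apply: eq_bigr => v vu; rewrite eq_sym vu mul1r.
  by field.
have sq_ge0 : 0 <= \sum_u y u ^+ 2 by apply: sumr_ge0 => u _; apply: sqr_ge0.
have := sqr_ge0 (\sum_u y u); split=> [|form0 u]; first lra.
have /eqP : \sum_u y u ^+ 2 = 0 by lra.
rewrite psumr_eq0 => [/allP/(_ u)|v _]; last exact: sqr_ge0.
by rewrite mem_index_enum sqrf_eq0 => /(_ isT)/eqP.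
Qed.

(** The square is completed at the middle vertex [b]. *)
Lemma pos_def_path3 : pos_def (path_graph 3).
Proof.
move=> y; set a := y ord0; set b := y (lift ord0 ord0).
set c := y (lift ord0 (lift ord0 ord0)).
have -> : adj_form y = 3 / 2 * (b + 2 / 3 * (a + c)) ^+ 2
          + 2 / 3 * (a - c) ^+ 2 + 1 / 6 * (a ^+ 2 + c ^+ 2).
  rewrite /adj_form !big_ord_recl !big_ord0 /= /path_adj /= -/a -/b -/c.
  by rewrite !mul0r !mul1r; field.
have := sqr_ge0 (b + 2 / 3 * (a + c)); have := sqr_ge0 (a - c).
have := sqr_ge0 a; have := sqr_ge0 c; split=> [|form0]; first lra.
have a0 : a = 0 by apply/eqP; rewrite -sqrf_eq0; apply/eqP; lra.
have c0 : c = 0 by apply/eqP; rewrite -sqrf_eq0; apply/eqP; lra.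
have b0 : b = 0.
  have /eqP : (b + 2 / 3 * (a + c)) ^+ 2 = 0 by lra.
  by rewrite sqrf_eq0 a0 c0 addr0 mulr0 addr0 => /eqP.
case=> [[|[|[|//]]] lt3]; [rewrite -a0|rewrite -b0|rewrite -c0];
  by congr (y _); apply: val_inj.
Qed.

(** Squares are completed at the pendant vertex [p], then in a + b; the dominating vertex [u] keeps
    the small positive weight 3/2 - 2/3 - 4/5 = 1/30. *)
Lemma pos_def_paw : pos_def paw.
Proof.
move=> y; set u := y (inl ord0); set p := y (inr (inl ord0)).
set a := y (inr (inr ord0)); set b := y (inr (inr (lift ord0 ord0))).
have -> : adj_form y = 3 / 2 * (p + 2 / 3 * u) ^+ 2
          + 5 / 4 * (a + b + 4 / 5 * u) ^+ 2 + 1 / 4 * (a - b) ^+ 2 + 1 / 30 * u ^+ 2.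
  rewrite /adj_form !big_sumType /= !big_ord_recl !big_ord0 /= -/u -/p -/a -/b.
  rewrite !big_sumType /= !big_ord_recl !big_ord0 /= -/u -/p -/a -/b.
  by rewrite /complete_adj /= ?mul0r ?mul1r; field.
have := sqr_ge0 (p + 2 / 3 * u); have := sqr_ge0 (a + b + 4 / 5 * u).
have := sqr_ge0 (a - b); have := sqr_ge0 u; split=> [|form0]; first lra.
have u0 : u = 0 by apply/eqP; rewrite -sqrf_eq0; apply/eqP; lra.
have p0 : p = 0.
  have /eqP : (p + 2 / 3 * u) ^+ 2 = 0 by lra.
  by rewrite sqrf_eq0 u0 mulr0 addr0 => /eqP.
have /eqP : (a - b) ^+ 2 = 0 by lra.
have /eqP : (a + b + 4 / 5 * u) ^+ 2 = 0 by lra.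
rewrite !sqrf_eq0 u0 mulr0 addr0 => /eqP ab0 /eqP ab.
have a0 : a = 0 by lra.
have b0 : b = 0 by lra.
case=> [i|[i|[[|[|//]] lt2]]]; rewrite ?ord1 //; [rewrite -a0|rewrite -b0];
  by congr (y (inr (inr _))); apply: val_inj.
Qed.
End PositiveDefinite.

(** With s the sum over H, the apex contributes y_0^2 / 2 + 2 y_0 s and H contributes 2 s^2 minus
    [adj_form]. *)
Lemma dist_form_join1 (R : rcfType) (H : sgraph) (y : join (complete 1) H -> R) :
  dist_form y y = 2 * (y (inl ord0) / 2 + \sum_h y (inr h)) ^+ 2
                  - adj_form (y \o inr).
Proof.
rewrite /dist_form /adj_form big_sumType /= big_ord_recl big_ord0 addr0.
rewrite big_sumType /= big_ord_recl big_ord0 addr0 /shifted_dist eqxx /=.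
set a := y _; set s := \sum_h y (inr h).
have -> : \sum_h a * y (inr h)
    * (2 - 3 / 2 * (inl ord0 == inr h :> join (complete 1) H)%:R - 1%:R) = a * s.
  by rewrite mulr_sumr; apply: eq_bigr => h _ /=; field.
have -> : \sum_h \sum_v y (inr h) * y v
    * (2 - 3 / 2 * (inr h == v)%:R - (adj (inr h : join (complete 1) H) v)%:R)
  = \sum_h (y (inr h) * a + 2 * (y (inr h) * s) - 3 / 2 * y (inr h) ^+ 2
            - \sum_k (adj h k)%:R * (y (inr h) * y (inr k))).
  apply: eq_bigr => h _; rewrite big_sumType /= big_ord_recl big_ord0 addr0.
  rewrite -/a [X in _ + X = _](_ : _ = 2 * (y (inr h) * s)
    - 3 / 2 * y (inr h) ^+ 2 - \sum_k (adj h k)%:R * (y (inr h) * y (inr k))).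
    by field.
  under eq_bigr => k _ do rewrite !mulrBr.
  rewrite !sumrB; congr (_ - _ - _).
  - by rewrite !mulr_sumr; apply: eq_bigr => k _; ring.
  - rewrite (bigD1 h) //= eqxx big1 ?addr0 => [|k kh]; first by rewrite /=; ring.
    rewrite [inr h == _](_ : _ = false) ?mulr0 //.
    by apply: contraNF kh => /eqP[->].
  - by apply: eq_bigr => k _; rewrite mulrC.
rewrite !sumrB !big_split /= -mulr_suml -!mulr_sumr -mulr_suml -/s.
by field.
Qed.

(** * From an embedding back to the eigenvalue bound *)

Section Converse.
Variables (R : rcfType) (G : sgraph).
Hypotheses (Gconn : connected G) (Gdiam : diameter G = 2%N).

(** The weight [wt] is the linear form squared in [dist_form_join1]. On its kernel only minus
    [adj_form] remains; if that vanishes, so do the coordinates on H, and the kernel equation then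
    kills the apex. *)
Lemma embedding_second_dist_eigenvalue (H : sgraph) (h : G -> join (complete 1) H) :
  pos_def R H -> injective h -> (forall u v, adj (h u) (h v) = adj u v) ->
  dist_eigenvalue R G 2 < - (1 / 2).
Proof.
move=> pH hinj hadj; pose wt (z : join (complete 1) H) : R := if z is inl _ then 1 / 2 else 1.
apply: (second_dist_eigenvalue_lt Gconn Gdiam (w := wt \o h)) => x [u0 xu0] xw.
(* Extension of [x] by 0 along [h]: each fibre has at most one vertex. *)
pose y z := \sum_(u | h u == z) x u.
have pushE (F : join (complete 1) H -> R) : \sum_u x u * F (h u) = \sum_z y z * F z.
  rewrite (partition_big h xpredT) //=; apply: eq_bigr => z _.
  by rewrite mulr_suml; apply: eq_bigr => u /eqP->.
have yh u : y (h u) = x u.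
  by rewrite /y (eq_bigl (pred1 u)) ?big_pred1_eq // => v; rewrite (inj_eq hinj).
have -> : dist_form x x = dist_form y y.
  transitivity (\sum_u x u * \sum_v x v * shifted_dist R (h u) (h v)).
    apply: eq_bigr => u _; rewrite mulr_sumr; apply: eq_bigr => v _.
    by rewrite -mulrA /shifted_dist hadj (inj_eq hinj).
  rewrite (pushE (fun z => \sum_v x v * shifted_dist R z (h v))).
  apply: eq_bigr => z _; rewrite (pushE (shifted_dist R z)) mulr_sumr.
  by apply: eq_bigr => v _; rewrite mulrA.
rewrite dist_form_join1.
have hyp0 : y (inl ord0) / 2 + \sum_v y (inr v) = 0.
  rewrite -[RHS]xw (pushE wt) big_sumType /= big_ord_recl big_ord0 addr0 mul1r.
  by congr (_ + _); apply: eq_bigr => v _; rewrite mulr1.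
rewrite hyp0 expr0n mulr0 sub0r oppr_lt0 lt_neqAle.
have [-> form0] := pH (y \o inr); rewrite andbT eq_sym.
apply: contra_neq xu0 => /form0 /= yr0.
move: hyp0; rewrite big1 // addr0 -yh => yl0.
case: (h u0) => [i|//]; rewrite ord1; lra.
Qed.
End Converse.

Theorem corollary1 (R : realType) (G : sgraph)
    (Gconn : connected G) (Gdiam : diameter G = 2%N) :
  dist_eigenvalue R G 2 < - (1 / 2) <->
  exists (k : nat) (p r : 'I_k -> nat) (q s : nat),
    [/\ (0 < k)%N, forall i, (0 < p i)%N, forall i, (0 < r i)%N,
        (0 < q)%N & (0 < s)%N] /\
    exists A : {set relaxed_block_star p r q s},
      connected (induced A) /\ iso G (induced A).
Proof.
split=> [l2|[k [p [r [q [s [_ [A [_ [h h_bij hadj]]]]]]]]]].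
  have [f [finj fadj]] := relaxed_block_star_embedding Gconn Gdiam l2.
  have G0 : (0 < #|G|)%N by have /andP[] := Gconn.
  (* A single block size, with every parameter equal to the order of [G], which is positive. *)
  exists 1%N, (fun=> #|G|), (fun=> #|G|), #|G|, #|G|; split=> //.
  exists [set f u | u in G].
  have isoG := iso_induced_image finj fadj.
  by split=> //; apply: iso_connected isoG Gconn.
apply: (embedding_second_dist_eigenvalue Gconn Gdiam (h := val \o h)).
- apply: pos_def_union; last exact/pos_def_big_union/(fun=> @pos_def_path3 R).
  apply: pos_def_union; last exact/pos_def_big_union/(fun=> @pos_def_paw R).
  apply: pos_def_big_union => i; apply: pos_def_big_union => j.
  exact: pos_def_complete.
- exact: inj_comp val_inj (bij_inj h_bij).
- exact: hadj.
Qed.
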